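(* Let $F$ be a field of characteristic two and let $(A,\sigma)$ and $(A',\sigma')$ be totally decomposable $F$-algebras with anisotropic orthogonal involution. Let $q'_\sigma$ (resp. $q'_{\sigma'}$) be the restriction of the alternator form $q_\sigma$ to $S'(A,\sigma)=S(A,\sigma)\cap\mathrm{Alt}(A,\sigma)$ (resp. of $q_{\sigma'}$ to $S'(A',\sigma')=S(A',\sigma')\cap\mathrm{Alt}(A',\sigma')$). Then $(A,\sigma)\simeq(A',\sigma')$ as $F$-algebras with involution if and only if $A\simeq A'$ as $F$-algebras and $q'_\sigma\simeq q'_{\sigma'}$ (isometry).
   Context: $F$ is a field of characteristic two; central simple algebras are finite-dimensional. An involution $\sigma$ on a central simple $F$-algebra $A$ is an anti-automorphism of order two; it is of the first kind if it is the identity on $F$. Put $\mathrm{Alt}(A,\sigma)=\{x-\sigma(x)\mid x\in A\}$. An involution of the first kind is orthogonal if and only if $1\notin\mathrm{Alt}(A,\sigma)$. For $\sigma$ orthogonal, define the alternator subalgebra $S(A,\sigma)=\{x\in A\mid \sigma(x)x\in F\oplus\mathrm{Alt}(A,\sigma)\}$ (it is a unitary $F$-subalgebra of $A$) and, for $x\in S(A,\sigma)$, let $q_\sigma(x)$ be the unique element of $F$ with $\sigma(x)x+q_\sigma(x)\in\mathrm{Alt}(A,\sigma)$; the map $q_\sigma:S(A,\sigma)\to F$ is a totally singular quadratic form (polar form zero), called the alternator form. The involution $\sigma$ is isotropic if $\sigma(x)x=0$ for some nonzero $x\in A$, anisotropic otherwise. $(A,\sigma)$ is totally decomposable if $(A,\sigma)\simeq\bigotimes_{i=1}^n(Q_i,\sigma_i)$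 with each $Q_i$ a quaternion $F$-algebra (central simple of degree 2) with involution $\sigma_i$. *)

(* Defs.v *)
From HB Require Import structures.
From mathcomp Require Import all_boot all_order all_algebra all_field.
From mathcomp Require Import boolp classical_sets functions.

Set Implicit Arguments.
Unset Strict Implicit.
Unset Printing Implicit Defensive.

Import GRing.Theory.
Local Open Scope ring_scope.
Local Open Scope classical_set_scope.

Section CentralSimple.
Variables (F : fieldType) (A : falgType F).

Definition central : Prop := ('Z({:A}) = 1)%VS.

(* A is nontrivial by virtue of falgType, and since it is unital its two-sided
   ideals are automatically F-subspaces. *)
Definition simple_alg : Prop :=
  forall I : {vspace A},
    ({:A} * I <= I)%VS -> (I * {:A} <= I)%VS -> I = 0%VS \/ I = {:A}%VS.

Definition central_simple : Prop := central /\ simple_alg.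

(* The degree of a central simple algebra is the square root of its
   dimension. *)
Definition quaternion_alg : Prop :=
  central_simple /\ \dim {:A} = (2 ^ 2)%N.

End CentralSimple.

Section Involution.
Variables (F : fieldType) (A : falgType F) (s : A -> A).

Definition is_involution : Prop :=
  [/\ {morph s : x y / x + y},
      {morph s : x y / x * y >-> y * x},
      involutive s
    & exists x, s x != x].

Definition first_kind : Prop := forall a : F, s a%:A = a%:A.

Definition Alt : set A := [set x - s x | x in [set: A]].

Definition orthogonal_involution : Prop :=
  [/\ is_involution, first_kind & ~ Alt 1].

Definition isotropic : Prop := exists x : A, x != 0 /\ s x * x = 0.
Definition anisotropic : Prop := ~ isotropic.

(* The sum of F and Alt is direct when s is orthogonal. *)
Definition alternator_subalg : set A :=
  [set x | exists (a : F) (y : A), Alt y /\ s x * x = a%:A + y].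

(* The unique a with s x * x + a in Alt; the value is junk outside
   alternator_subalg. *)
Definition alternator_form (x : A) : F :=
  xget 0 [set a : F | Alt (s x * x + a%:A)].

Definition alternating_alternators : set A := alternator_subalg `&` Alt.

End Involution.

Section TensorProduct.
Variables (F : fieldType) (n : nat) (Q : 'I_n -> falgType F).

(* dfwith x u is the family x with its i-th entry replaced by u : Q i. *)
Definition multilinear (W : lmodType F) (f : (forall i, Q i) -> W) : Prop :=
  forall (x : forall i, Q i) (i : 'I_n) (a : F) (u v : Q i),
    f (dfwith x (a *: u + v)) = a *: f (dfwith x u) + f (dfwith x v).

(* (A, m) is the tensor product over F of the algebras Q i, with m sending
   a family x to the pure tensor of the x i: A has the universal property of
   the tensor product of vector spaces, and its multiplication is the
   componentwise one on pure tensors. *)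
Definition is_tensor_product (A : falgType F) (m : (forall i, Q i) -> A) :
    Prop :=
  [/\ multilinear m,
      forall (W : lmodType F) (f : (forall i, Q i) -> W), multilinear f ->
        exists g : {linear A -> W}, (forall x, g (m x) = f x) /\
          forall h : {linear A -> W}, (forall x, h (m x) = f x) -> h =1 g,
      forall x y, m (fun i => x i * y i) = m x * m y
    & m (fun=> 1) = 1].

End TensorProduct.

Definition totally_decomposable (F : fieldType) (A : falgType F)
    (s : A -> A) : Prop :=
  exists (n : nat) (Q : 'I_n -> falgType F) (t : forall i, Q i -> Q i)
      (m : (forall i, Q i) -> A),
    [/\ (0 < n)%N,
        forall i, quaternion_alg (Q i) /\ is_involution (t i),
        is_tensor_product m
      & forall x, s (m x) = m (fun i => t i (x i))].

Definition alg_isomorphic (F : fieldType) (A A' : falgType F) : Prop :=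
  exists f : {lrmorphism A -> A'}, bijective f.

Definition alg_inv_isomorphic (F : fieldType) (A A' : falgType F)
    (s : A -> A) (s' : A' -> A') : Prop :=
  exists f : {lrmorphism A -> A'}, bijective f /\ forall x, f (s x) = s' (f x).

(* Isometry of the quadratic spaces (U, q) and (U', q'), where U and U' are
   subspaces of V and V'; f is only relevant on U and q, q' on U, U'. *)
Definition isometric (F : fieldType) (V V' : lmodType F)
    (U : set V) (q : V -> F) (U' : set V') (q' : V' -> F) : Prop :=
  exists f : V -> V',
    [/\ forall (a : F) x y, U x -> U y -> f (a *: x + y) = a *: f x + f y,
        set_bij U U' f
      & forall x, U x -> q' (f x) = q x].

(* Main.v *)
(* For sigma totally decomposable, each quaternion factor is generated by
   symmetric u_i, v_i with u_i v_i + v_i u_i = v_i, u_i ^ 2 + u_i in F and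
   v_i ^ 2 in F^*.  Let K be the commutant of the v_i.  Splitting off one u_i at
   a time shows that K is commutative, that sigma is trivial on K, that squares
   in K are scalars and that K = F + S', where S' is the intersection of K with
   Alt; anisotropy makes K a field and gives S(A, sigma) = K, with
   q_sigma(x) = x ^ 2 on K.

   Given an isomorphism phi : A -> A' and an isometry f : S' -> S'', the
   elements phi^-1 (f v_i) commute and have the same squares as the v_i, hence
   are conjugate to them by some x in A: a nonzero intertwiner is easily found,
   and anisotropy makes it invertible.  Then Phi(a) = phi(x a x^-1) agrees with
   f on S', since a square root in a field of characteristic two is unique.
   Finally k = sigma'(Phi u_i) + Phi u_i lies in Phi(K), and k Phi(K) is
   contained in Alt(A', sigma'); as 1 is not alternating, k = 0.  So sigma' Phi
   and Phi sigma agree on the generators u_i, v_i of A. *)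

From HB Require Import structures.
Require Import Defs.
From mathcomp Require Import all_boot all_order all_algebra all_field.
From mathcomp Require Import boolp classical_sets functions.
From mathcomp Require Import zify.

Set Implicit Arguments.
Unset Strict Implicit.
Unset Printing Implicit Defensive.

Import GRing.Theory.

(** * Computation in rings of characteristic two *)

Section CharTwo.
Local Open Scope ring_scope.
Variables (R : nzRingType) (charR2 : 2%N \in [pchar R]).

Lemma addr_eq0_pchar2 (x y : R) : x + y = 0 -> x = y.
Proof. by move/eqP; rewrite addr_eq0 (oppr_pchar2 charR2) => /eqP. Qed.

Lemma cancel_skip (x y r r' : R) : x + r = r' -> x + (y + r) = y + r'.
Proof. by rewrite addrCA => ->. Qed.

Lemma cancel_last (x y : R) : x + x = 0 -> x + (y + x) = y.
Proof. by rewrite addrCA => ->; rewrite addr0. Qed.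

Lemma cancel_head (x r r' : R) : x + r = r' -> r' = 0 -> x + r = 0.
Proof. by move=> -> ->. Qed.

End CharTwo.

(* Noncommutative ring identities in characteristic two: expand into a sum of
   monomials and cancel equal terms in pairs. *)
Ltac cancel_in charR :=
  first
  [ exact: (addKr_pchar2 charR)
  | refine (cancel_last _ (addrr_pchar2 charR _))
  | refine (cancel_skip _ _); cancel_in charR ].

Ltac cancel_pairs charR :=
  first
  [ reflexivity
  | exact: (addrr_pchar2 charR)
  | eapply cancel_head; [ cancel_in charR | cancel_pairs charR ] ].

Ltac char2 charR :=
  apply: (addr_eq0_pchar2 charR);
  rewrite ?(mulrDl, mulrDr, scalerDr, =^~ scalerAl, =^~ scalerAr, mulr1, mul1r,
            mul0r, mulr0, scaler0, scalerA, =^~ addrA, =^~ mulrA, addr0, add0r);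
  cancel_pairs charR.

(** * Involutions of the first kind and their alternating elements *)

Section Involution.
Local Open Scope ring_scope.
Variables (F : fieldType) (charF2 : 2%N \in [pchar F]) (A : falgType F).
Variables (s : A -> A).
Hypotheses (invs : is_involution s) (fks : first_kind s).

Let charA2 : 2%N \in [pchar A]. Proof. by rewrite pchar_lalg. Qed.

Lemma involD x y : s (x + y) = s x + s y. Proof. by case: invs. Qed.
Lemma involM x y : s (x * y) = s y * s x. Proof. by case: invs. Qed.
Lemma involK x : s (s x) = x. Proof. by case: invs. Qed.

Lemma invol1 : s 1 = 1.
Proof. by rewrite -[1]scale1r fks. Qed.

Lemma involZ a x : s (a *: x) = a *: s x.
Proof. by rewrite -mulr_algl involM fks mulr_algr. Qed.

Lemma invol0 : s 0 = 0.
Proof. by rewrite -(scale0r (1 : A)) involZ !scale0r. Qed.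

Lemma invol_linear : linear s.
Proof. by move=> a x y; rewrite involD involZ. Qed.

Lemma AltP z : Alt s z <-> exists w, z = w + s w.
Proof.
split=> [[w _ <-]|[w ->]]; exists w => //.
  by rewrite (oppr_pchar2 charA2).
by rewrite (oppr_pchar2 charA2).
Qed.

Lemma Alt_tr w : Alt s (w + s w).
Proof. by apply/AltP; exists w. Qed.

Lemma Alt0 : Alt s 0.
Proof. by apply/AltP; exists 0; rewrite invol0 addr0. Qed.

Lemma Alt_add x y : Alt s x -> Alt s y -> Alt s (x + y).
Proof.
move=> /AltP[w ->] /AltP[z ->]; apply/AltP; exists (w + z).
by rewrite involD; char2 charA2.
Qed.

Lemma Alt_scale a x : Alt s x -> Alt s (a *: x).
Proof.
by move=> /AltP[w ->]; apply/AltP; exists (a *: w); rewrite involZ scalerDr.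
Qed.

Lemma Alt_conj x y : Alt s x -> Alt s (s y * x * y).
Proof.
move=> /AltP[w ->]; apply/AltP; exists (s y * w * y).
by rewrite !involM involK; char2 charA2.
Qed.

Lemma Alt_sym x : Alt s x -> s x = x.
Proof. by move=> /AltP[w ->]; rewrite involD involK addrC. Qed.

Hypothesis (ort : ~ Alt s 1).

Lemma Alt_scalar a : Alt s a%:A -> a = 0.
Proof.
have [//|a0 /(Alt_scale a^-1)] := eqVneq a 0.
by rewrite scalerA mulVf // scale1r => /ort.
Qed.

Hypothesis (anis : anisotropic s).

Lemma anisP x : s x * x = 0 -> x = 0.
Proof.
move=> sx; have [//|x0] := eqVneq x 0.
by case: anis; exists x.
Qed.

End Involution.

(** * Symmetric generators of a product of quaternion algebras *)

Section Generators.
Local Open Scope ring_scope.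

(** Generation of [A] is expressed by subspaces that contain 1 and are closed under products; below
    these are a centralizer and the set where two anti-homomorphisms agree. *)
Record symbol_generators (F : fieldType) (A : falgType F) (s : A -> A)
    (n : nat) (u v : 'I_n -> A) : Prop := {
  gen_symu : forall i, s (u i) = u i;
  gen_symv : forall i, s (v i) = v i;
  gen_commu : forall i j, u i * u j = u j * u i;
  gen_commv : forall i j, v i * v j = v j * v i;
  gen_commuv : forall i j, i != j -> u i * v j = v j * u i;
  gen_uv : forall i, u i * v i + v i * u i = v i;
  gen_sqru : forall i, exists c : F, u i * u i + u i = c%:A;
  gen_sqrv : forall i, exists2 a : F, a != 0 & v i * v i = a%:A;
  gen_full : forall V : {vspace A}, 1 \in V ->
    (forall x y, x \in V -> y \in V -> x * y \in V) ->
    (forall i, u i \in V) -> (forall i, v i \in V) -> V = {:A}%VS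
}.

End Generators.

(** * The commutant [K] of the [v i] *)

Section Symbols.
Local Open Scope ring_scope.
Variables (F : fieldType) (charF2 : 2%N \in [pchar F]) (A : falgType F).
Variables (s : A -> A) (n : nat) (u v : 'I_n -> A).
Hypotheses (invs : is_involution s) (fks : first_kind s).
Hypotheses (centA : central A) (uvA : symbol_generators s u v).

Let charA2 : 2%N \in [pchar A]. Proof. by rewrite pchar_lalg. Qed.

Lemma centralP (x : A) : (forall y, x * y = y * x) -> exists a : F, x = a%:A.
Proof.
move=> xC; have : x \in 'Z({:A})%VS.
  by rewrite memv_cap memvf; apply/centvP => y _; rewrite xC.
by rewrite centA => /vlineP.
Qed.

Lemma gen_centralP (x : A) : (forall i, x * u i = u i * x) ->
  (forall i, x * v i = v i * x) -> exists a : F, x = a%:A.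
Proof.
move=> xu xv; apply: centralP => y.
have : y \in {:A}%VS by rewrite memvf.
rewrite -(@gen_full _ _ _ _ _ _ uvA 'C[x]%VS) ?cent1v1 //.
- by move/cent1vP.
- move=> y1 y2 /cent1vP y1x /cent1vP y2x; apply/cent1vP.
  by rewrite -mulrA y2x !mulrA y1x.
- by move=> i; apply/cent1vP.
- by move=> i; apply/cent1vP.
Qed.

Definition cent_gens (x : A) := forall i, x * v i = v i * x.

Lemma cent_gensM x y : cent_gens x -> cent_gens y -> cent_gens (x * y).
Proof. by move=> xv yv i; rewrite -mulrA yv !mulrA xv. Qed.

Lemma cent_gensD x y : cent_gens x -> cent_gens y -> cent_gens (x + y).
Proof. by move=> xv yv i; rewrite mulrDl mulrDr xv yv. Qed.

Lemma cent_gensZ a x : cent_gens x -> cent_gens (a *: x).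
Proof. by move=> xv i; rewrite -scalerAl xv -scalerAr. Qed.

Lemma cent_gens1 : cent_gens 1.
Proof. by move=> i; rewrite mulr1 mul1r. Qed.

Lemma cent_gens_v i : cent_gens (v i).
Proof. by move=> j; apply: (gen_commv uvA). Qed.

Lemma gen_vu i : v i * u i = u i * v i + v i.
Proof. by rewrite -{3}(gen_uv uvA i); char2 charA2. Qed.

(** By the Jacobi identity, bracketing with [v j] leaves only the bracket of [x] with that of [u i]
    and [v j]; the latter is [v i] or 0, and [x] commutes with both. *)
Lemma cent_gens_bracket x i : cent_gens x -> cent_gens (x * u i + u i * x).
Proof.
move=> xv j; have [<-|ij] := eqVneq i j.
  rewrite mulrDl mulrDr !mulrA -xv -!mulrA gen_vu xv [u i * (v i * x)]mulrA.
  rewrite [v i * (u i * x)]mulrA gen_vu mulrDr mulrDl [x * v i]xv; char2 charA2.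
rewrite mulrDl mulrDr !mulrA -xv -mulrA (gen_commuv uvA ij) mulrA.
by rewrite -[u i * x * v j]mulrA xv -(gen_commuv uvA ij) !mulrA.
Qed.

(* As [u k ^+ 2 + u k] is a scalar, bracketing with [u k] is idempotent: [a] and
   [b * v k] are the components of [x] in its eigenspaces for 0 and 1. *)
Lemma cent_gens_split (x : A) (k : 'I_n) : cent_gens x ->
    (forall i : 'I_n, (i < k)%N -> x * u i = u i * x) ->
  exists a b, [/\ x = a + b * v k, cent_gens a, cent_gens b &
    forall i : 'I_n, (i <= k)%N -> a * u i = u i * a /\ b * u i = u i * b].
Proof.
move=> xv xu; set y := x * u k + u k * x.
have yv : cent_gens y by apply: cent_gens_bracket.
have [c uc] := gen_sqru uvA k; have [d d0 vd] := gen_sqrv uvA k.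
have uu : u k * u k = u k + c *: 1 by rewrite -uc; char2 charA2.
have yuk : y * u k = u k * y + y.
  rewrite /y mulrDl mulrDr -!mulrA uu [u k * (u k * x)]mulrA uu; char2 charA2.
have yu (i : 'I_n) : (i < k)%N -> y * u i = u i * y.
  move=> ik; have := gen_commu uvA i k => uik.
  rewrite mulrDl mulrDr [u i * (x * _)]mulrA -(xu _ ik) -!mulrA uik.
  by rewrite (xu _ ik) [u k * (u i * x)]mulrA -uik !mulrA.
exists (x + y), (d^-1 *: (y * v k)).
split; last 1 first.
- move=> i; rewrite leq_eqVlt => /predU1P[/val_inj ->|ik].
    split; first by rewrite mulrDl yuk /y; char2 charA2.
    rewrite -scalerAl -scalerAr; congr (_ *: _).
    by rewrite -mulrA gen_vu mulrDr !mulrA yuk; char2 charA2.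
  split; first by rewrite mulrDl mulrDr xu // yu.
  have uik : u i * v k = v k * u i.
    by apply: (gen_commuv uvA); rewrite neq_ltn ik.
  by rewrite -scalerAl -scalerAr -mulrA -uik !mulrA yu.
- rewrite -scalerAl -mulrA vd mulr_algr scalerA mulVf // scale1r.
  by char2 charA2.
- exact: cent_gensD.
- by apply/cent_gensZ/cent_gensM => //; apply: cent_gens_v.
Qed.

Lemma cent_gens_structure x : cent_gens x ->
  [/\ s x = x, exists (a : F) y, Alt s y /\ x = a%:A + y
    & exists c : F, x * x = c%:A].
Proof.
(* Induction on the number [k] of last generators [u i] with which [x] need not commute. For
   [k = 0], [x] is central, hence a scalar. *)
have main k : (k <= n)%N -> forall x, cent_gens x ->
    (forall i : 'I_n, (i < n - k)%N -> x * u i = u i * x) ->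
  [/\ s x = x, exists (a : F) y, Alt s y /\ x = a%:A + y
    & exists c : F, x * x = c%:A].
  elim: k => [_|k IH kn] {}x xv xu.
    have [|a ->] := gen_centralP _ xv.
      by move=> i; apply: xu; rewrite subn0.
    split; first by rewrite fks.
      exists a, 0; rewrite addr0; split=> //.
      exact: Alt0.
    by exists (a * a); rewrite mulr_algl scalerA.
  have nk : (n - k.+1 < n)%N by rewrite ltn_subrL (leq_ltn_trans _ kn).
  have [//|a [b [xE av bv abu]]] := @cent_gens_split x (Ordinal nk) xv.
  set j := Ordinal nk in xE abu.
  have lej (i : 'I_n) : (i < n - k)%N -> (i <= j)%N.
    by move=> ik; rewrite -ltnS /= subnSK.
  have IHk := IH (ltnW kn).
  have [sa [l [y [ya ay]]] [c ac]] := IHk a av (fun i h => (abu i (lej i h)).1).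
  have [sb _ [d bd]] := IHk b bv (fun i h => (abu i (lej i h)).2).
  have [e e0 ve] := gen_sqrv uvA j.
  have svj := gen_symv uvA j.
  (* Since [b] commutes with [u j] and [v j], the element [b * u j * v j] plus its image under [s]
     is [b * (u j * v j + v j * u j) = b * v j]. *)
  have Abv : Alt s (b * v j).
    apply/AltP => //; exists (b * (u j * v j)).
    rewrite !(involM invs) svj (gen_symu uvA) sb -{1}(gen_uv uvA j) mulrDr.
    congr (_ + _); rewrite -mulrA -(abu j (leqnn _)).2 !mulrA.
    by rewrite bv.
  (* The induction hypothesis makes [a * b] symmetric, like [a] and [b]. *)
  have Cab : a * b = b * a.
    have [||<- _ _] := IHk (a * b); first exact: cent_gensM.
      move=> i /lej /abu [au bu].
      by rewrite -mulrA bu !mulrA au.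
    by rewrite (involM invs) sa sb.
  split.
  - by rewrite xE (involD invs) (involM invs) svj sa sb bv.
  - exists l, (y + b * v j); split; first exact: Alt_add.
    by rewrite xE ay addrA.
  - exists (c + d * e).
    have bva : b * v j * a = a * (b * v j).
      by rewrite -mulrA -av mulrA -Cab -mulrA.
    rewrite xE mulrDr !mulrDl ac bva.
    have -> : b * v j * (b * v j) = (d * e)%:A.
      rewrite -mulrA [v j * _]mulrA -bv -mulrA ve !mulrA bd -scalerAl mul1r.
      exact: scalerA.
    rewrite scalerDl; char2 charA2.
by move=> xv; apply: (main n (leqnn n)) => // i; rewrite subnn.
Qed.

End Symbols.

(** * The alternator subalgebra and intertwiners in the anisotropic case *)

Section Direct.
Local Open Scope ring_scope.
Variables (F : fieldType) (charF2 : 2%N \in [pchar F]) (A : falgType F).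
Variables (s : A -> A) (n : nat) (u v : 'I_n -> A).
Hypotheses (invs : is_involution s) (fks : first_kind s) (ort : ~ Alt s 1).
Hypotheses (centA : central A) (uvA : symbol_generators s u v).
Hypothesis (anis : anisotropic s).

Let charA2 : 2%N \in [pchar A]. Proof. by rewrite pchar_lalg. Qed.

Lemma cent_gens_sym (x : A) : cent_gens v x -> s x = x.
Proof.
by move=> xv; have [] := cent_gens_structure charF2 invs fks centA uvA xv.
Qed.

Lemma cent_gens_sqr (x : A) : cent_gens v x -> exists c : F, x * x = c%:A.
Proof.
by move=> xv; have [] := cent_gens_structure charF2 invs fks centA uvA xv.
Qed.

Lemma cent_gens_Alt (x : A) : cent_gens v x ->
  exists (a : F) y, [/\ Alt s y, cent_gens v y & x = a%:A + y].
Proof.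
move=> xv.
have [_ [a [y [ya xE]]] _] := cent_gens_structure charF2 invs fks centA uvA xv.
exists a, y; split=> //; have -> : y = x + a *: 1 by rewrite xE; char2 charA2.
by apply: cent_gensD => //; apply: cent_gensZ; apply: cent_gens1.
Qed.

(** [K] is closed under products and fixed pointwise by [s], which reverses products. *)
Lemma cent_gens_comm (x y : A) :
  cent_gens v x -> cent_gens v y -> x * y = y * x.
Proof.
move=> xv yv; have := cent_gens_sym (cent_gensM xv yv).
by rewrite (involM invs) !cent_gens_sym.
Qed.

Lemma cent_gens_sqr0 (x : A) : cent_gens v x -> x * x = 0 -> x = 0.
Proof. by move=> xv xx; apply: (anisP anis); rewrite cent_gens_sym. Qed.

(** [x * x] is a scalar, nonzero by anisotropy, so a multiple of [x] is its inverse. *)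
Lemma cent_gens_inv (x : A) : cent_gens v x -> x != 0 ->
  exists2 y, cent_gens v y & x * y = 1.
Proof.
move=> xv x0; have [c xx] := cent_gens_sqr xv.
exists (c^-1 *: x); first exact: cent_gensZ.
rewrite -scalerAr xx scalerA mulVf ?scale1r //.
apply: contraNneq x0 => c0; apply/eqP/cent_gens_sqr0 => //.
by rewrite xx c0 scale0r.
Qed.

(** With [w = v i], [w * w = a] and [s x * x = b + y], the product expands to [w * (s x * x) * w],
    [a *: (s x * x)] and a sum [z + s z]. The scalar parts [a * b] of the first two terms cancel. *)
Lemma alternator_bracket (x : A) i : alternator_subalg s x ->
  Alt s (s (x * v i + v i * x) * (x * v i + v i * x)).
Proof.
move=> [b [y [ya xE]]]; have [a _ va] := gen_sqrv uvA i.
have sv := gen_symv uvA i; set w := v i in va sv *.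
rewrite (involD invs) !(involM invs) sv.
have -> : (w * s x + s x * w) * (x * w + w * x) =
    s w * y * w + a *: y + (s x * w * x * w + s (s x * w * x * w)).
  rewrite !(involM invs) (involK invs) sv.
  have -> : (w * s x + s x * w) * (x * w + w * x) =
    w * (s x * x) * w + s x * (w * w) * x + s x * w * x * w + w * s x * w * x.
    by char2 charA2.
  have -> : s x * (w * w) * x = a *: (s x * x).
    by rewrite va -scalerAr mulr1 -scalerAl.
  have -> : w * (s x * x) * w = (b * a)%:A + w * y * w.
    by rewrite xE mulrDr mulrDl mulr_algr -scalerAl va scalerA.
  rewrite xE scalerDr scalerA mulrC; char2 charA2.
apply: (Alt_add charF2 invs); last exact: (Alt_tr charF2).
by apply: (Alt_add charF2 invs); [exact: Alt_conj | exact: Alt_scale].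
Qed.

(* Bracketing with the [v i] preserves the condition on [x], and kills [x] or
   moves it into the commutant of the [v i], on which [s x * x = x ^+ 2]. *)
Lemma alternator_direct (x : A) : Alt s (s x * x) -> x = 0.
Proof.
suff main k : (k <= n)%N -> forall x, Alt s (s x * x) ->
    (forall i : 'I_n, (k <= i)%N -> x * v i = v i * x) -> x = 0.
  by move=> xA; apply: (main n) => // i; rewrite leqNgt ltn_ord.
elim: k => [_|k IH kn] {}x xA xv.
  have {}xv : cent_gens v x by move=> i; apply: xv.
  have [c xx] := cent_gens_sqr xv; apply: cent_gens_sqr0 => //.
  move: xA; rewrite cent_gens_sym // xx => /(Alt_scalar charF2 invs fks ort) ->.
  by rewrite scale0r.
pose j := Ordinal kn; have [a _ va] := gen_sqrv uvA j.
(* The bracket commutes with [v j] because [v j] squares to a scalar, and with the later [v i]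
   because [x] and [v j] do. *)
have y0 : x * v j + v j * x = 0.
  apply: IH; first exact: ltnW.
    apply: alternator_bracket; exists 0, (s x * x).
    by rewrite scale0r add0r.
  move=> i; rewrite leq_eqVlt => /predU1P[ji|ki].
    have -> : i = j by apply: val_inj.
    rewrite mulrDl mulrDr -mulrA [v j * (v j * x)]mulrA va mulr_algr mulr_algl.
    by char2 charA2.
  rewrite mulrDl mulrDr -!mulrA xv // (gen_commv uvA j i) [x * (_ * _)]mulrA.
  rewrite xv //.
  by rewrite [v i * (v j * x)]mulrA -(gen_commv uvA j i) !mulrA.
apply: IH (ltnW kn) _ xA _ => i; rewrite leq_eqVlt => /predU1P[ji|/xv //].
have -> : i = j by apply: val_inj.
exact: (addr_eq0_pchar2 charA2).
Qed.

(** For [x] in the alternator subalgebra, [alternator_direct] applies to its bracket with each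
    [v i]. Conversely, on [K] the element [s x * x] is the scalar [x * x]. *)
Lemma alternator_subalgE (x : A) : alternator_subalg s x <-> cent_gens v x.
Proof.
split=> [xA i|xv].
  apply: (addr_eq0_pchar2 charA2); apply: alternator_direct.
  exact: alternator_bracket.
have [c xx] := cent_gens_sqr xv; exists c, 0; split; first exact: (Alt0 charF2).
by rewrite cent_gens_sym // addr0.
Qed.

Lemma alternator_form_sqr (x : A) : cent_gens v x ->
  x * x = (alternator_form s x)%:A.
Proof.
move=> xv; have [c xx] := cent_gens_sqr xv.
rewrite xx /alternator_form cent_gens_sym // xx (@xget_unique _ _ _ c) //=.
  by rewrite (addrr_pchar2 charA2); apply: (Alt0 charF2).
move=> b; rewrite -scalerDl => /(Alt_scalar charF2 invs fks ort).
by move/(addr_eq0_pchar2 charF2).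
Qed.

Lemma alternating_alternatorsE (x : A) :
  alternating_alternators s x <-> cent_gens v x /\ Alt s x.
Proof.
by split=> -[xs xa]; split=> //; apply/alternator_subalgE.
Qed.

(** Starting from 1, [x] is replaced by [w j * x + x * v j] for one [j] after another, unless this
    is 0, in which case [x] already intertwines [w j] and [v j]. The new element works for [j]
    because [w j] and [v j] have the same scalar square, and for earlier indices by
    commutativity. *)
Lemma exists_intertwiner (w : 'I_n -> A) :
    (forall i j, w i * w j = w j * w i) ->
    (forall i, w i * w i = v i * v i) ->
  exists2 x, x != 0 & forall i, w i * x = x * v i.
Proof.
move=> ww wv.
suff main k : (k <= n)%N ->
    exists2 x, x != 0 & forall i : 'I_n, (i < k)%N -> w i * x = x * v i.
  by have [x x0 wx] := main n (leqnn n); exists x => // i; apply: wx.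
elim: k => [_|k IH kn]; first by exists 1; rewrite ?oner_neq0.
have [x x0 wx] := IH (ltnW kn); pose j := Ordinal kn.
have [y0|y0] := eqVneq (w j * x + x * v j) 0.
  exists x => // i; rewrite ltnS leq_eqVlt => /predU1P[ij|/wx //].
  have -> : i = j by apply: val_inj.
  exact: (addr_eq0_pchar2 charA2).
exists (w j * x + x * v j) => // i; rewrite ltnS leq_eqVlt => /predU1P[ij|ik].
  have -> : i = j by apply: val_inj.
  have [a _ va] := gen_sqrv uvA j.
  rewrite mulrDl mulrDr mulrA wv -[x * v j * v j]mulrA va mulr_algr mulr_algl.
  by char2 charA2.
rewrite mulrDr mulrDl !mulrA ww -[w j * w i * x]mulrA wx // mulrA.
by rewrite -[x * v i * v j]mulrA (gen_commv uvA) !mulrA.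
Qed.

(* Anisotropy makes the right annihilator of [x] a direct summand [e A] with
   [e] a symmetric idempotent commuting with the [v i]; these form a field. *)
Lemma intertwiner_unit (w : 'I_n -> A) (x : A) :
    x != 0 -> (forall i, w i * x = x * v i) ->
  exists2 x', x * x' = 1 & x' * x = 1.
Proof.
move=> x0 wx; have [y yE] : exists y, y = s x * x by exists (s x * x).
have sy : s y = y by rewrite yE (involM invs) (involK invs).
have kery a : y * a = 0 -> x * a = 0.
  move=> ya; apply: (anisP anis).
  by rewrite (involM invs) -mulrA [s x * _]mulrA -yE ya mulr0.
(* If [z = y * b] and [y * z = 0], then [s z * z = s b * y * z = 0]. So kernel and image of left
   multiplication by [y] are complementary. *)
have capy : (lker (amull y) :&: limg (amull y))%VS = 0%VS.
  apply/eqP; rewrite -subv0; apply/subvP => z.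
  rewrite memv_cap memv_ker lfunE /= => /andP[/eqP yz /memv_imgP[b _ zE]].
  rewrite memv0; apply/eqP/(anisP anis).
  by rewrite {1}zE lfunE /= (involM invs) sy -mulrA yz mulr0.
have sumy : (lker (amull y) + limg (amull y))%VS = {:A}%VS.
  apply/eqP; rewrite eqEdim subvf /= dimv_disjoint_sum // addnC.
  by rewrite -(limg_ker_dim (amull y) {:A}) capfv addnC.
have : 1 \in (lker (amull y) + limg (amull y))%VS by rewrite sumy memvf.
move=> /memv_addP[e]; rewrite memv_ker lfunE /= => /eqP ye.
move=> [_ /memv_imgP[b _ ->]].
rewrite lfunE /= => e1.
have xe : x * e = 0 by apply: kery.
(* The bracket [z] satisfies [x * z = 0], so [s z] kills both [y] and [v i * y] from the left. As
   [z] lies in [y A + v i y A], this gives [s z * z = 0]. *)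
have ev : cent_gens v e.
  move=> i; apply: (addr_eq0_pchar2 charA2).
  set z := e * v i + v i * e.
  have xz : x * z = 0.
    by rewrite mulrDr !mulrA xe mul0r -wx -mulrA xe mulr0 addr0.
  have zE : z = y * b * v i + v i * (y * b).
    have ybE : y * b = 1 + e by rewrite e1; char2 charA2.
    by rewrite ybE /z; char2 charA2.
  have sy0 : s z * y = 0.
    by rewrite -{1}sy -(involM invs) yE -mulrA xz mulr0 (invol0 invs fks).
  have svy : s z * v i * y = 0.
    have -> : s z * v i * y = s (y * (v i * z)).
      by rewrite (involM invs) sy (involM invs) (gen_symv uvA).
    rewrite yE -mulrA [x * _]mulrA -wx -[w i * x * _]mulrA xz !mulr0.
    exact: (invol0 invs fks).
  apply: (anisP anis); rewrite {2}zE mulrDr !mulrA sy0 svy !mul0r addr0 //.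
have ee : e * e = e.
  have ey : e * y = 0.
    rewrite -[e * y](involK invs) (involM invs) sy (cent_gens_sym ev) ye.
    exact: (invol0 invs fks).
  by rewrite -{3}[e]mulr1 e1 mulrDr mulrA ey mul0r addr0.
have e0 : e = 0.
  have [//|ne0] := eqVneq e 0; have [f _ ef] := cent_gens_inv ev ne0.
  by case/eqP: x0; rewrite -[x]mulr1 -ef mulrA xe mul0r.
have yb : y * b = 1 by rewrite e1 e0 add0r.
(* Such an [a] lies in the kernel for [y], and in the image as [a = y * (b * a)]. *)
have inj a : x * a = 0 -> a = 0.
  move=> xa; have ya : a \in lker (amull y).
    by rewrite memv_ker lfunE /= yE -mulrA xa mulr0.
  apply/eqP; rewrite -memv0 -capy memv_cap ya; apply/memv_imgP.
  by exists (b * a); rewrite ?memvf // lfunE /= mulrA yb mul1r.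
have kx : lker (amull x) = 0%VS.
  apply/eqP; rewrite -subv0; apply/subvP => a.
  by rewrite memv_ker lfunE memv0 /= => /eqP /inj ->.
have : 1 \in limg (amull x).
  suff -> : limg (amull x) = {:A}%VS by rewrite memvf.
  by apply/eqP; rewrite eqEdim subvf /= limg_dim_eq // kx capv0.
case/memv_imgP => x' _; rewrite lfunE /= => xx'; exists x' => //.
apply/eqP; rewrite -subr_eq0; apply/eqP/inj.
by rewrite mulrBr mulrA -xx' mul1r mulr1 subrr.
Qed.

End Direct.

(** * Quaternion algebras with anisotropic orthogonal involution *)

Section Quaternion.
Local Open Scope ring_scope.
Variables (F : fieldType) (charF2 : 2%N \in [pchar F]) (Q : falgType F).
Variable t : Q -> Q.
Hypotheses (invt : is_involution t) (fkt : first_kind t) (ort : ~ Alt t 1).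
Hypotheses (anis : anisotropic t) (quatQ : quaternion_alg Q).

Let charQ2 : 2%N \in [pchar Q]. Proof. by rewrite pchar_lalg. Qed.

(** The map [D = 1 + t] squares to 0, and 1 is in its kernel but not in its image. Kernel and image
    have total dimension 4, so the image has dimension at most 1; it is nonzero since [t] is not the
    identity. *)
Lemma quaternion_Alt_line : exists2 v, v != 0 &
  Alt t v /\ forall z, Alt t z -> exists k, z = k *: v.
Proof.
pose tl : {linear Q -> Q} :=
  HB.pack t (GRing.isLinear.Build F Q Q *:%R t (invol_linear invt fkt)).
pose D : 'End(Q) := (\1 + linfun tl)%VF.
have DE x : D x = x + t x. by rewrite add_lfunE id_lfunE lfunE.
have kerD x : (x \in lker D) = (t x == x).
  rewrite memv_ker DE; apply/eqP/eqP => [|->]; last exact: addrr_pchar2.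
  by move/(addr_eq0_pchar2 charQ2).
have sub : (limg D <= lker D)%VS.
  apply/subvP => _ /memv_imgP[x _ ->]; rewrite kerD DE.
  by rewrite (involD invt) (involK invt) addrC.
have ltD : (\dim (limg D) < \dim (lker D))%N.
  rewrite ltn_neqAle dimvS // andbT; apply: contra_notN ort => dimE.
  have : 1 \in limg D.
    have /eqP -> : limg D == lker D by rewrite eqEdim sub (eqP dimE) /=.
    by rewrite kerD (invol1 fkt).
  by case/memv_imgP => x _; rewrite DE => xE; apply/(AltP charF2); exists x.
have dimD := limg_ker_dim D {:Q}.
rewrite capfv quatQ.2 in dimD.
have [x xt] : exists x, t x != x by case: invt.
have v0 : D x != 0 by rewrite -memv_ker kerD.
exists (D x) => //; split; first by apply/(AltP charF2); exists x; rewrite DE.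
move=> z /(AltP charF2)[y zE]; apply/vlineP.
suff <- : limg D = <[D x]>%VS by rewrite zE -DE memv_img ?memvf.
apply/esym/eqP; rewrite eqEdim -memvE memv_img ?memvf //= dim_vline v0.
by rewrite -ltnS -(ltn_add2l (\dim (lker D))) dimD; move: ltD dimD; lia.
Qed.

(** As [t v * v * v] is alternating, [v * v * v = l *: v]. If [z = v * v + l] were nonzero,
    [l^-1 *: z] would be a symmetric idempotent [e] killing [v]; it turns out to be central, hence a
    scalar, hence 0. *)
Lemma quaternion_Alt_sqr v : v != 0 -> Alt t v ->
    (forall z, Alt t z -> exists k, z = k *: v) ->
  exists2 a : F, a != 0 & v * v = a%:A.
Proof.
move=> v0 Av line; have tv := Alt_sym charF2 invt Av.
have [l vvv] := line _ (Alt_conj charF2 invt v Av); rewrite tv in vvv.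
have [z zE] : exists z, z = v * v + l%:A by exists (v * v + l%:A).
have zv : z * v = 0.
  by rewrite zE mulrDl vvv mulr_algl (addrr_pchar2 charQ2).
have vz : v * z = 0.
  by rewrite zE mulrDr mulrA vvv mulr_algr (addrr_pchar2 charQ2).
have tz : t z = z by rewrite zE (involD invt) (involM invt) tv fkt.
have vvE : v * v = z + l%:A by rewrite zE; char2 charQ2.
have zz : z * z = l *: z.
  by rewrite {1}zE mulrDl -mulrA vz mulr0 add0r mulr_algl.
have z0 : z = 0.
  have [//|zn0] := eqVneq z 0.
  have l0 : l != 0.
    apply: contra_neq zn0 => l0; apply: (anisP anis).
    by rewrite tz zz l0 scale0r.
  have [e eE] : exists e, e = l^-1 *: z by exists (l^-1 *: z).
  have ee : e * e = e.
    by rewrite eE -scalerAl -scalerAr zz (scalerA l^-1 l) mulVf ?scale1r.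
  have ev : e * v = 0 by rewrite eE -scalerAl zv scaler0.
  have te : t e = e by rewrite eE (involZ invt fkt) tz.
  (* The element [e * x * (1 + e)] plus its image under [t] is a multiple of [v]. Multiplying by [e]
     on the left and [1 + e] on the right kills both this multiple and the image. *)
  have exe x : e * x = e * x * e.
    have [k kE] := line _ (Alt_tr charF2 t (e * x * (1 + e))).
    move/(congr1 (fun x => e * x * (1 + e))): kE.
    rewrite -scalerAr ev scaler0 mul0r.
    rewrite !(involM invt) (involD invt) (invol1 fkt) te => kE.
    apply: (addr_eq0_pchar2 charQ2); rewrite -[RHS]kE.
    have e1 : e * (1 + e) = 0 by rewrite mulrDr mulr1 ee (addrr_pchar2 charQ2).
    have e1e : (1 + e) * (1 + e) = 1 + e.
      by rewrite mulrDl e1 addr0 mul1r.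
    rewrite [e * (_ + _)]mulrDr !mulrA e1 !mul0r addr0 ee -!mulrA e1e.
    by char2 charQ2.
  have [|a ea] := @centralP _ _ quatQ.1.1 e.
    move=> x; rewrite exe; have := congr1 t (exe (t x)).
    by rewrite !(involM invt) te (involK invt) => ->; rewrite mulrA.
  have a0 : a = 0.
    apply/eqP; move/eqP: ev; rewrite ea mulr_algl scaler_eq0.
    by rewrite (negPf v0) orbF.
  by rewrite -(scale1r z) -(mulfV l0) -scalerA -eE ea a0 scale0r scaler0.
rewrite z0 add0r in vvE; exists l => //; apply: contra_neq v0 => l0.
by apply: (anisP anis); rewrite tv vvE l0 scale0r.
Qed.

(** Write [v = w + t w] and [v * w + t (v * w) = m *: v]. Then [w * (v + m)] is symmetric; if it
    commuted with [v], then [v * v = m * m], so [v + m] would square to 0 and [v] would be an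
    alternating scalar. *)
Lemma quaternion_sym_noncentral v : v != 0 -> Alt t v ->
    (forall z, Alt t z -> exists k, z = k *: v) ->
  exists2 x, t x = x & x * v + v * x != 0.
Proof.
move=> v0 Av line; have tv := Alt_sym charF2 invt Av.
have [l l0 vv] := quaternion_Alt_sqr v0 Av line.
have [w wE] := (AltP charF2 t v).1 Av.
have tw : t w = w + v by rewrite wE; char2 charQ2.
have [m mE] := line _ (Alt_tr charF2 t (v * w)).
rewrite (involM invt) tw tv mulrDl vv in mE.
apply: contrapT => none.
have comm x : t x = x -> x * v = v * x.
  move=> tx; apply: (addr_eq0_pchar2 charQ2).
  have [//|ne] := eqVneq (x * v + v * x) 0.
  by case: none; exists x.
have vwE : v * w = w * v + l%:A + m *: v by rewrite -mE; char2 charQ2.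
have tg : t (w * (v + m%:A)) = w * (v + m%:A).
  rewrite (involM invt) (involD invt) tv fkt tw mulrDl !mulrDr vwE vv.
  by char2 charQ2.
have gv := comm _ tg.
have lm : l = m * m.
  apply: (addr_eq0_pchar2 charF2); apply: contraTeq isT => lm0.
  have : (l + m * m) *: v = 0.
    rewrite -[RHS](addrr_pchar2 charQ2 (w * (v + m%:A) * v)) {2}gv.
    rewrite [v * (w * _)]mulrA vwE scalerDl.
    rewrite !(mulrDl, mulrDr) -!mulrA -!(scalerAl, scalerAr) vv.
    rewrite !(mulr1, mul1r, scalerA) [m * l]mulrC; char2 charQ2.
  by move/eqP; rewrite scaler_eq0 (negPf lm0) (negPf v0).
have vm : v = m%:A.
  apply: (addr_eq0_pchar2 charQ2); apply: (anisP anis).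
  rewrite (involD invt) tv fkt mulrDl !mulrDr vv lm.
  by char2 charQ2.
have := Av; rewrite vm => /(Alt_scalar charF2 invt fkt ort) m0.
by case/eqP: v0; rewrite vm m0 scale0r.
Qed.

(** [v] spans the alternating elements and [u] is a symmetric element not commuting with [v], scaled
    so that the alternating element [u * v + v * u] equals [v]. *)
Lemma quaternion_generators : exists u v : Q, [/\ t u = u, t v = v,
  u * v + v * u = v, exists c : F, u * u + u = c%:A &
  (exists2 a : F, a != 0 & v * v = a%:A) /\
  forall x, exists a b c d : F, x = a%:A + b *: u + c *: v + d *: (u * v)].
Proof.
have [v v0 [Av line]] := quaternion_Alt_line.
have tv := Alt_sym charF2 invt Av.
have [l l0 vv] := quaternion_Alt_sqr v0 Av line.
have [x tx xv] := quaternion_sym_noncentral v0 Av line.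
have [k kE] := line _ (Alt_tr charF2 t (x * v)).
rewrite (involM invt) tx tv in kE.
have k0 : k != 0 by apply: contra_neq xv => k0; rewrite kE k0 scale0r.
have [u uE] : exists u, u = k^-1 *: x by exists (k^-1 *: x).
have uv : u * v + v * u = v.
  by rewrite uE -scalerAl -scalerAr -scalerDr kE scalerA mulVf // scale1r.
have scal a b : a%:A + b *: v = 0 -> a = 0 /\ b = 0.
  move=> ab; suff b0 : b = 0.
    split=> //; move/eqP: ab.
    by rewrite b0 scale0r addr0 scaler_eq0 oner_eq0 orbF => /eqP.
  apply: contra_notP ort => /eqP b0.
  have a0 : a != 0.
    apply: contraTneq isT => a0; move/eqP: ab.
    by rewrite a0 scale0r add0r scaler_eq0 (negPf b0) (negPf v0).
  have -> : 1 = (a^-1 * b) *: v.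
    rewrite -scalerA -(addr_eq0_pchar2 charQ2 ab) scalerA mulVf //.
    by rewrite scale1r.
  exact: Alt_scale.
have vu : v * u = u * v + v by rewrite -{3}uv; char2 charQ2.
have span (y : Q) : exists a b c d : F,
    y = a%:A + b *: u + c *: v + d *: (u * v).
  pose X := [tuple 1; u; v; u * v].
  have freeX : free X.
    apply/freeP => f; rewrite !big_ord_recl big_ord0 /= addr0 !addrA.
    set a := f _; set b := f _; set c := f _; set d := f _ => sum0.
    (* The bracket with [v] kills 1 and [v], and sends [u] to [v] and [u * v] to [l]. *)
    have [bl0 b0] : d * l = 0 /\ b = 0.
      apply: scal; have : 0 * v + v * 0 = 0 :> Q by rewrite mul0r mulr0 addr0.
      rewrite -sum0 => bv; rewrite -[RHS]bv.
      rewrite !(mulrDl, mulrDr) -!(scalerAl, scalerAr) mulrA vu -mulrA vv.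
      rewrite mulrDl !mulr1 !mul1r -mulrA vv mulr_algr -scalerA; char2 charQ2.
    have d0 : d = 0.
      by apply/eqP; move/eqP: bl0; rewrite mulf_eq0 (negPf l0) orbF.
    rewrite b0 d0 !scale0r !addr0 in sum0; have [a0 c0] := scal _ _ sum0.
    move=> i; case: (unliftP ord0 i) => [j ->|-> //].
    case: (unliftP ord0 j) => [{}j ->|-> //].
    case: (unliftP ord0 j) => [{}j ->|-> //].
    by case: (unliftP ord0 j) => [[]|->].
  have /coord_basis/(_ (memvf y)) -> : basis_of {:Q} X.
    by rewrite basisEfree freeX subvf size_tuple quatQ.2.
  rewrite !big_ord_recl big_ord0 /= addr0 !addrA.
  by do 4!eexists.
exists u, v; split=> //; first by rewrite uE (involZ invt fkt) tx.
  2: by split; first by exists l.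
have [|c ->] := @centralP _ _ quatQ.1.1 (u * u + u); last by exists c.
move=> y; have [a [b [c [d ->]]]] := span y.
have [z zE] : exists z, z = u * u + u by exists (u * u + u).
rewrite -zE.
have zu : z * u = u * z by rewrite zE mulrDr mulrDl mulrA.
have zv : z * v = v * z.
  rewrite zE mulrDr mulrDl mulrA vu mulrDl -!mulrA vu mulrDr; char2 charQ2.
rewrite !mulrDr !mulrDl -!scalerAl -!scalerAr mulr1 mul1r zu zv.
by rewrite mulrA zu -!mulrA zv.
Qed.

End Quaternion.

(** * Quaternion factors inside their tensor product *)

Section TensorFactors.
Local Open Scope ring_scope.
Variables (F : fieldType) (charF2 : 2%N \in [pchar F]) (A : falgType F).
Variables (n : nat) (Q : 'I_n -> falgType F) (m : (forall i, Q i) -> A).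
Hypothesis tensm : is_tensor_product m.

(** The canonical map from a factor to the tensor product. *)
Definition factor_embed i (x : Q i) : A := m (dfwith (fun j => 1 : Q j) x).

Lemma factor_embed_linear i : linear (@factor_embed i).
Proof. by case: tensm => lin _ _ _ a x y; rewrite /factor_embed lin. Qed.

Lemma factor_embedM i (x y : Q i) :
  factor_embed (x * y) = factor_embed x * factor_embed y.
Proof.
have [_ _ mM _] := tensm; rewrite /factor_embed -mM; congr m.
apply: functional_extensionality_dep => j.
have [<-|ij] := eqVneq i j; first by rewrite !dfwith_in.
by rewrite !dfwith_out // mulr1.
Qed.

Lemma factor_embed1 i : factor_embed (1 : Q i) = 1.
Proof.
have [_ _ _ m1] := tensm; rewrite /factor_embed -[RHS]m1; congr m.
apply: functional_extensionality_dep => j.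
by have [<-|ij] := eqVneq i j; rewrite ?dfwith_in ?dfwith_out.
Qed.

Lemma factor_embedD i (x y : Q i) :
  factor_embed (x + y) = factor_embed x + factor_embed y.
Proof. by have := factor_embed_linear 1 x y; rewrite !scale1r. Qed.

Lemma factor_embedZ i a (x : Q i) : factor_embed (a *: x) = a *: factor_embed x.
Proof.
have e0 : factor_embed (0 : Q i) = 0.
  apply: (@addrI _ (factor_embed (0 : Q i))).
  by rewrite -factor_embedD !addr0.
by have := factor_embed_linear a x 0; rewrite e0 !addr0.
Qed.

Lemma factor_embed_comm i j (x : Q i) (y : Q j) : i != j ->
  factor_embed x * factor_embed y = factor_embed y * factor_embed x.
Proof.
move=> ij; have [_ _ mM _] := tensm; rewrite /factor_embed -!mM; congr m.
apply: functional_extensionality_dep => k.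
have [ik|ik] := eqVneq i k.
  by rewrite [dfwith _ y k]dfwith_out ?mulr1 ?mul1r // -ik eq_sym.
by rewrite [dfwith _ x k]dfwith_out // mulr1 mul1r.
Qed.

(** The kernel is a two-sided ideal that does not contain 1. *)
Lemma factor_embed_inj i : simple_alg (Q i) -> injective (@factor_embed i).
Proof.
move=> simp.
pose f : {linear Q i -> A} := HB.pack (@factor_embed i)
  (GRing.isLinear.Build F (Q i) A *:%R (@factor_embed i)
     (@factor_embed_linear i)).
have kerE x : (x \in lker (linfun f)) = (factor_embed x == 0).
  by rewrite memv_ker lfunE.
have [| |k0|k1] := simp (lker (linfun f)).
- apply/prodvP => x y _; rewrite !kerE => /eqP y0.
  by rewrite factor_embedM y0 mulr0.
- apply/prodvP => x y; rewrite !kerE => /eqP x0 _.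
  by rewrite factor_embedM x0 mul0r.
- move=> x y xy; apply/eqP; rewrite -subr_eq0 -memv0 -k0 kerE.
  rewrite factor_embedD -scaleN1r factor_embedZ scaleN1r xy subrr //.
- have : (1 : Q i) \in lker (linfun f) by rewrite k1 memvf.
  by rewrite kerE factor_embed1 oner_eq0.
Qed.

(** By uniqueness in the universal property, the identity minus a projection onto [V] is 0, as it
    vanishes on pure tensors. *)
Lemma tensor_span (V : {vspace A}) : (forall x, m x \in V) -> V = {:A}%VS.
Proof.
move=> mV; have [_ univ _ _] := tensm.
have mul0 : multilinear (fun _ : forall i, Q i => (0 : A)).
  by move=> x i a y z; rewrite scaler0 addr0.
have [g [_ guniq]] := univ A _ mul0.
pose h : 'End(A) := (\1 - projv V)%VF.
have hE x : h x = x - projv V x by rewrite add_lfunE opp_lfunE id_lfunE.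
have h0 : h =1 g.
  by apply: guniq => y; apply: etrans (hE _) _; rewrite projv_id ?subrr.
have z0 : (0 : 'End(A))%VF =1 g by apply: guniq => y; apply: zero_lfunE.
apply/eqP; rewrite eqEsubv subvf /=; apply/subvP => x _.
have : h x = 0 by rewrite h0 -z0 zero_lfunE.
by rewrite hE => /eqP; rewrite subr_eq0 => /eqP ->; apply: memv_proj.
Qed.

(** A pure tensor is the product of its embedded entries, multiplied in one at a time. *)
Lemma tensor_generated (V : {vspace A}) : 1 \in V ->
    (forall x y, x \in V -> y \in V -> x * y \in V) ->
  (forall i (x : Q i), factor_embed x \in V) -> V = {:A}%VS.
Proof.
move=> V1 VM Vf; apply: tensor_span => x; have [_ _ mM m1] := tensm.
suff main k : (k <= n)%N -> m (fun i => if (i < k)%N then x i else 1) \in V.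
  have := main n (leqnn n); congr (m _ \in V).
  by apply: functional_extensionality_dep => i; rewrite ltn_ord.
elim: k => [_|k IH kn]; first by rewrite m1.
pose j := Ordinal kn.
suff -> : m (fun i => if (i < k.+1)%N then x i else 1) =
    m (fun i => if (i < k)%N then x i else 1) * factor_embed (x j).
  by apply: VM => //; apply/IH/ltnW.
rewrite /factor_embed -mM; congr m; apply: functional_extensionality_dep => i.
have [<-|ji] := eqVneq j i; first by rewrite dfwith_in ltnSn ltnn mul1r.
rewrite dfwith_out // mulr1 ltnS leq_eqVlt.
by case: eqP => // ik; case/eqP: ji; apply: val_inj.
Qed.

Variables (s : A -> A) (t : forall i, Q i -> Q i).
Hypothesis st : forall x, s (m x) = m (fun i => t (x i)).
Hypothesis invt : forall i, is_involution (@t i).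

Lemma factor_embed_inv i (x : Q i) : s (factor_embed x) = factor_embed (t x).
Proof.
have t1 j : @t j 1 = 1.
  have [_ tM tK _] := invt j.
  by have := tM 1 (@t j 1); rewrite mul1r tK mul1r.
rewrite /factor_embed st; congr m; apply: functional_extensionality_dep => j.
have [<-|ij] := eqVneq i j; first by rewrite !dfwith_in.
by rewrite !dfwith_out.
Qed.

Hypotheses (fks : first_kind s) (ort : ~ Alt s 1) (anis : anisotropic s).
Hypothesis quatQ : forall i, quaternion_alg (Q i).

(** First kind, orthogonality and anisotropy pass from [s] to [t] along the embedding. *)
Lemma factor_generators i : exists u v : Q i, [/\ t u = u, t v = v,
  u * v + v * u = v, exists c : F, u * u + u = c%:A &
  (exists2 a : F, a != 0 & v * v = a%:A) /\
  forall x, exists a b c d : F, x = a%:A + b *: u + c *: v + d *: (u * v)].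
Proof.
have inj := @factor_embed_inj i (quatQ i).1.2.
apply: (quaternion_generators charF2 (invt i)) (quatQ i).
- move=> a; apply: inj.
  by rewrite -factor_embed_inv factor_embedZ factor_embed1 fks.
- move=> /(AltP charF2)[w w1]; apply: ort; apply/(AltP charF2).
  exists (factor_embed w).
  by rewrite factor_embed_inv -factor_embedD -w1 factor_embed1.
- move=> [x [x0 tx]]; apply: anis; exists (factor_embed x); split.
    apply: contra_neq x0 => x0; apply: inj; rewrite x0.
    by rewrite -(scale0r (0 : Q i)) factor_embedZ scale0r.
  rewrite factor_embed_inv -factor_embedM tx -(scale0r (0 : Q i)).
  by rewrite factor_embedZ scale0r.
Qed.

Lemma tensor_generators : exists u v : 'I_n -> A, symbol_generators s u v.
Proof.
pose u i := sval (cid (factor_generators i)).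
pose v i := sval (cid (svalP (cid (factor_generators i)))).
have uv i : [/\ t (u i) = u i, t (v i) = v i, u i * v i + v i * u i = v i,
    exists c : F, u i * u i + u i = c%:A &
    (exists2 a : F, a != 0 & v i * v i = a%:A) /\
    forall x, exists a b c d : F,
      x = a%:A + b *: u i + c *: v i + d *: (u i * v i)].
  exact: (svalP (cid (svalP (cid (factor_generators i))))).
have scalar i a : factor_embed (a%:A : Q i) = a%:A.
  by rewrite factor_embedZ factor_embed1.
exists (fun i => factor_embed (u i)), (fun i => factor_embed (v i)); split.
- by move=> i; rewrite factor_embed_inv; case: (uv i) => ->.
- by move=> i; rewrite factor_embed_inv; case: (uv i) => _ ->.
- by move=> i j; have [->//|ij] := eqVneq i j; apply: factor_embed_comm.
- by move=> i j; have [->//|ij] := eqVneq i j; apply: factor_embed_comm.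
- by move=> i j; apply: factor_embed_comm.
- by move=> i; rewrite -!factor_embedM -factor_embedD; case: (uv i) => _ _ ->.
- move=> i; have [_ _ _ [c uc] _] := uv i; exists c.
  by rewrite -factor_embedM -factor_embedD uc.
- move=> i; have [_ _ _ _ [[a a0 va] _]] := uv i; exists a => //.
  by rewrite -factor_embedM va.
move=> V V1 VM Vu Vv; apply: tensor_generated => // i x.
have [_ _ _ _ [_ /(_ x)[a [b [c [d ->]]]]]] := uv i.
rewrite !factor_embedD !factor_embedZ factor_embedM factor_embed1.
by rewrite !memvD // memvZ // VM.
Qed.

End TensorFactors.

(** * Invariance of the alternator form under isomorphism *)

Section Isomorphism.
Local Open Scope ring_scope.
Variables (F : fieldType) (A A' : falgType F) (s : A -> A) (s' : A' -> A').
Variable f : {lrmorphism A -> A'}.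
Hypotheses (bijf : bijective f) (fs : forall x, f (s x) = s' (f x)).

Let fD a b : f (a + b) = f a + f b. Proof. exact: rmorphD. Qed.
Let fB a b : f (a - b) = f a - f b. Proof. exact: rmorphB. Qed.
Let fM a b : f (a * b) = f a * f b. Proof. exact: rmorphM. Qed.
Let falg a : f a%:A = a%:A.
Proof. by rewrite linearZ rmorph1. Qed.

Lemma iso_Alt x : Alt s' (f x) <-> Alt s x.
Proof.
have [g fK gK] := bijf.
split=> [[y _ yE]|[y _ <-]]; last by exists (f y); rewrite // fB fs.
by exists (g y) => //; apply: (can_inj fK); rewrite fB fs gK.
Qed.

Lemma iso_alternator_subalg x :
  alternator_subalg s' (f x) <-> alternator_subalg s x.
Proof.
have [g fK gK] := bijf.
split=> -[a [y [ya xE]]]; last first.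
  exists a, (f y); split; first exact/iso_Alt.
  by rewrite -fs -fM xE fD falg.
exists a, (g y); split; first by apply/iso_Alt; rewrite gK.
by apply: (can_inj fK); rewrite fM fD falg fs gK.
Qed.

(** The two sets of admissible scalars coincide, so even the default values agree. *)
Lemma iso_alternator_form x : alternator_form s' (f x) = alternator_form s x.
Proof.
congr (xget _ _); apply/funext => a; apply/propext.
by rewrite /= -fs -fM -falg -fD; apply: iso_Alt.
Qed.

Lemma iso_isometric : isometric
  (alternating_alternators s) (alternator_form s)
  (alternating_alternators s') (alternator_form s').
Proof.
have [g fK gK] := bijf.
exists f; split; last by move=> x _; exact: iso_alternator_form.
  by move=> a x y _ _; rewrite linearP.
have sub x : alternating_alternators s' (f x) <-> alternating_alternators s x.
  by split=> -[/iso_alternator_subalg ? /iso_Alt ?].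
split; first by move=> x /sub.
  by move=> x y _ _; apply: (can_inj fK).
by move=> y y'; exists (g y); rewrite ?gK //; apply/sub; rewrite gK.
Qed.

End Isomorphism.

(** * Isomorphisms twisted by an inner automorphism *)

Section Conjugate.
Local Open Scope ring_scope.
Variables (F : fieldType) (A A' : falgType F) (f : {lrmorphism A -> A'}).
Variables (x x' : A).
Hypotheses (xx' : x * x' = 1) (x'x : x' * x = 1).

Definition conjugate (a : A) : A' := f (x * a * x').

Fact conjugate_is_linear : linear conjugate.
Proof.
move=> c a b; rewrite /conjugate -linearP mulrDr mulrDl.
by rewrite -scalerAr -scalerAl.
Qed.

Fact conjugate_is_monoid_morphism : monoid_morphism conjugate.
Proof.
split=> [|a b]; rewrite /conjugate ?mulr1 ?xx' ?rmorph1 // -rmorphM.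
rewrite -[x * a * x' * _]mulrA [x' * (_ * x')]mulrA [x' * (x * _)]mulrA x'x.
by rewrite mul1r !mulrA.
Qed.

End Conjugate.

(** * From an isometry to an isomorphism of algebras with involution *)

Section Backward.
Local Open Scope ring_scope.
Variables (F : fieldType) (charF2 : 2%N \in [pchar F]) (A A' : falgType F).
Variables (s : A -> A) (s' : A' -> A') (n n' : nat).
Variables (u v : 'I_n -> A) (u' v' : 'I_n' -> A').
Hypotheses (invs : is_involution s) (fks : first_kind s) (ort : ~ Alt s 1).
Hypotheses (centA : central A) (uvA : symbol_generators s u v).
Hypothesis (anis : anisotropic s).
Hypotheses (invs' : is_involution s') (fks' : first_kind s').
Hypotheses (ort' : ~ Alt s' 1) (centA' : central A').
Hypotheses (uvA' : symbol_generators s' u' v') (anis' : anisotropic s').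

Let charA2 : 2%N \in [pchar A]. Proof. by rewrite pchar_lalg. Qed.
Let charA2' : 2%N \in [pchar A']. Proof. by rewrite pchar_lalg. Qed.

Let altE := alternating_alternatorsE charF2 invs fks ort centA uvA anis.
Let altE' := alternating_alternatorsE charF2 invs' fks' ort' centA' uvA' anis'.

Lemma gen_alternating i : alternating_alternators s (v i).
Proof.
apply/altE; split; first exact: (cent_gens_v uvA).
apply/(AltP charF2); exists (u i * v i).
by rewrite (involM invs) (gen_symu uvA) (gen_symv uvA) (gen_uv uvA).
Qed.

Lemma isomorphism_of_isometry (f : A -> A') (phi : {lrmorphism A -> A'}) :
    bijective phi ->
    set_fun (alternating_alternators s) (alternating_alternators s') f ->
    (forall x, alternating_alternators s x ->
       alternator_form s' (f x) = alternator_form s x) ->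
  alg_inv_isomorphic s s'.
Proof.
move=> [psi phiK psiK] ffun fq.
have fK x : alternating_alternators s x -> cent_gens v' (f x).
  by move=> /ffun /altE'[].
have f2 x : alternating_alternators s x ->
    exists c : F, x * x = c%:A /\ f x * f x = c%:A.
  move=> xs; exists (alternator_form s x).
  have [xv _] := (altE x).1 xs.
  split; first exact: (alternator_form_sqr charF2 invs fks ort centA uvA).
  rewrite -fq //.
  by apply: (alternator_form_sqr charF2 invs' fks' ort' centA' uvA'); apply: fK.
have fcomm x y : alternating_alternators s x -> alternating_alternators s y ->
    f x * f y = f y * f x.
  move=> xs ys.
  by apply: (cent_gens_comm charF2 invs' fks' centA' uvA'); apply: fK.
have algphi c : phi c%:A = c%:A by rewrite linearZ rmorph1.
have phi_inj := can_inj phiK.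
have ww i j : psi (f (v i)) * psi (f (v j)) = psi (f (v j)) * psi (f (v i)).
  apply: phi_inj; rewrite !rmorphM /= !psiK.
  by apply: fcomm; apply: gen_alternating.
have wv i : psi (f (v i)) * psi (f (v i)) = v i * v i.
  have [c [-> fc]] := f2 _ (gen_alternating i).
  by apply: phi_inj; rewrite rmorphM /= psiK fc algphi.
have [x x0 wx] := exists_intertwiner charF2 uvA ww wv.
have [x' xx' x'x] := intertwiner_unit charF2 invs fks centA uvA anis x0 wx.
pose Phi : {lrmorphism A -> A'} := HB.pack (conjugate phi x x')
  (GRing.isLinear.Build F A A' *:%R (conjugate phi x x')
     (conjugate_is_linear phi x x'))
  (GRing.isMonoidMorphism.Build A A' (conjugate phi x x')
     (conjugate_is_monoid_morphism phi xx' x'x)).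
have PhiE a : Phi a = phi (x * a * x') by [].
have bijPhi : bijective Phi.
  exists (fun b => x' * psi b * x) => a.
    by rewrite PhiE phiK !mulrA x'x mul1r -mulrA x'x mulr1.
  by rewrite PhiE !mulrA xx' mul1r -mulrA xx' mulr1 psiK.
have Phiv i : Phi (v i) = f (v i).
  by rewrite PhiE -wx -mulrA xx' mulr1 psiK.
clearbody Phi; move: bijPhi => [Psi PhiK PsiK].
have Phi_inj := can_inj PhiK.
have PhiD a b : Phi (a + b) = Phi a + Phi b by exact: rmorphD.
have PhiM a b : Phi (a * b) = Phi a * Phi b by exact: rmorphM.
have Phi0 : Phi 0 = 0 by exact: rmorph0.
have Phi1 : Phi 1 = 1 by exact: rmorph1.
have Phialg c : Phi c%:A = c%:A by rewrite linearZ rmorph1.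
have Phif y : alternating_alternators s y -> Phi y = f y.
  move=> ys; have [yv _] := (altE y).1 ys.
  suff yE : y = Psi (f y) by rewrite {1}yE PsiK.
  (* [f y] commutes with [f (v i)], which is [Phi (v i)]. *)
  have kv : cent_gens v (Psi (f y)).
    move=> i; apply: Phi_inj; rewrite !PhiM PsiK Phiv.
    by apply: fcomm => //; apply: gen_alternating.
  have [c [yy fyy]] := f2 _ ys.
  have kk : Psi (f y) * Psi (f y) = y * y.
    by apply: Phi_inj; rewrite PhiM PsiK fyy yy Phialg.
  apply: (addr_eq0_pchar2 charA2).
  apply: (cent_gens_sqr0 charF2 invs fks centA uvA anis).
    exact: cent_gensD.
  rewrite mulrDl !mulrDr kk (cent_gens_comm charF2 invs fks centA uvA kv yv).
  by char2 charA2.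
(* [K] is the sum of the scalars and [S'], and on [S'] the map [Phi] is [f], whose values commute
   with the [v' i] and are thus fixed by [s']. *)
have sPhi b : cent_gens v b -> s' (Phi b) = Phi b.
  move=> bv.
  have [l [y [ya yv ->]]] := cent_gens_Alt charF2 invs fks centA uvA bv.
  have ys : alternating_alternators s y by apply/altE.
  rewrite PhiD Phialg (Phif y ys) (involD invs') fks'.
  by rewrite (cent_gens_sym charF2 invs' fks' centA' uvA' (fK y ys)).
have sU i : s' (Phi (u i)) = Phi (u i).
  set k := Psi (s' (Phi (u i)) + Phi (u i)).
  have PhikE : Phi k = s' (Phi (u i)) + Phi (u i) by rewrite PsiK.
  (* The bracket of [u i] and [v j] is [v i] or 0, so its image under [Phi] is fixed by [s']. As
     [Phi (v j)] is also fixed, [Phi k] commutes with it. *)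
  have kv : cent_gens v k.
    move=> j; apply: Phi_inj; rewrite !PhiM PhikE.
    have sV : s' (Phi (v j)) = Phi (v j) by apply/sPhi/(cent_gens_v uvA).
    have brac : cent_gens v (u i * v j + v j * u i).
      have [<-|ij] := eqVneq i j.
        by rewrite (gen_uv uvA); apply: (cent_gens_v uvA).
      rewrite (gen_commuv uvA ij) (addrr_pchar2 charA2) => h.
      by rewrite mul0r mulr0.
    have := sPhi _ brac.
    rewrite PhiD !PhiM (involD invs') !(involM invs') sV.
    set br := Phi (u i) * _ + _ => e.
    apply: (addr_eq0_pchar2 charA2'); rewrite -[RHS](addrr_pchar2 charA2' br).
    by rewrite -{1}e; char2 charA2'.
  (* This is [z + s' z] for [z = Phi b * Phi (u i)], plus the image under [f] of the alternating
     element [b * u i + u i * b] of [K]. *)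
  have Altk b : cent_gens v b -> Alt s' (Phi (k * b)).
    move=> bv; have su := gen_symu uvA i.
    have bs : alternating_alternators s (b * u i + u i * b).
      apply/altE; split; first exact: (cent_gens_bracket charF2 uvA).
      apply/(AltP charF2); exists (b * u i).
      by rewrite (involM invs) su (cent_gens_sym charF2 invs fks centA uvA bv).
    have [_ fbs] := (altE' _).1 (ffun _ bs).
    have -> : Phi (k * b) = (Phi b * Phi (u i) + s' (Phi b * Phi (u i))) +
        f (b * u i + u i * b).
      rewrite -(Phif _ bs) PhiD !PhiM PhikE (involM invs') (sPhi b bv).
      by char2 charA2'.
    by apply: (Alt_add charF2 invs') => //; apply: Alt_tr.
  have k0 : k = 0.
    have [//|kn0] := eqVneq k 0.
    have [b bv kb] := cent_gens_inv charF2 invs fks centA uvA anis kv kn0.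
    by case: ort'; rewrite -Phi1 -kb; apply: Altk.
  by apply: (addr_eq0_pchar2 charA2'); rewrite -PhikE k0 Phi0.
exists Phi; split; first by exists Psi.
(* Both compositions become linear maps, so that the set where they agree is a kernel, to which
   [gen_full] applies. *)
pose sl : {linear A -> A} :=
  HB.pack s (GRing.isLinear.Build F A A *:%R s (invol_linear invs fks)).
pose sl' : {linear A' -> A'} :=
  HB.pack s' (GRing.isLinear.Build F A' A' *:%R s' (invol_linear invs' fks')).
pose l := (linfun sl' \o linfun Phi)%VF.
pose r := (linfun Phi \o linfun sl)%VF.
have lE a : l a = s' (Phi a).
  apply: etrans (comp_lfunE _ _ _) _.
  apply: etrans (lfunE sl' _) _.
  by apply: (congr1 s'); apply: lfunE.
have rE a : r a = Phi (s a).
  apply: etrans (comp_lfunE _ _ _) _.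
  apply: etrans (lfunE Phi _) _.
  by apply: (congr1 Phi); apply: (lfunE sl).
clearbody l r.
have kerE b : (b \in lker (l - r)) = (s' (Phi b) == Phi (s b)).
  by apply/eqlfunP/eqP; rewrite lE rE.
move=> a; apply/esym/eqP; rewrite -kerE.
rewrite (gen_full uvA (V := lker (l - r))) ?memvf //.
- by rewrite kerE (invol1 fks) Phi1 (invol1 fks').
- move=> b c; rewrite !kerE => /eqP bE /eqP cE.
  by rewrite (involM invs) !PhiM (involM invs') bE cE.
- by move=> i; rewrite kerE (gen_symu uvA) sU.
- by move=> i; rewrite kerE (gen_symv uvA) sPhi //; apply: (cent_gens_v uvA).
Qed.

End Backward.

Theorem theorem4p10 (F : fieldType) (charF2 : 2 \in [pchar F]%R)
    (A A' : falgType F) (s : A -> A) (s' : A' -> A')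
    (csA : central_simple A) (csA' : central_simple A')
    (tdA : totally_decomposable s) (tdA' : totally_decomposable s')
    (orthA : orthogonal_involution s) (orthA' : orthogonal_involution s')
    (anisA : anisotropic s) (anisA' : anisotropic s') :
  alg_inv_isomorphic s s' <->
  (alg_isomorphic A A' /\
   isometric (alternating_alternators s) (alternator_form s)
             (alternating_alternators s') (alternator_form s')).
Proof.
split=> [[f [bijf fs]]|[[phi bijphi] [f [_ [ffun _ _] fq]]]].
  by split; [exists f | exact: iso_isometric bijf fs].
have [invs fks ort] := orthA; have [invs' fks' ort'] := orthA'.
have [n [Q [t [m [_ Qt tensm st]]]]] := tdA.
have [n' [Q' [t' [m' [_ Qt' tensm' st']]]]] := tdA'.
have [u [v uvA]] := tensor_generators charF2 tensm st (fun i => (Qt i).2)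
  fks ort anisA (fun i => (Qt i).1).
have [u' [v' uvA']] := tensor_generators charF2 tensm' st' (fun i => (Qt' i).2)
  fks' ort' anisA' (fun i => (Qt' i).1).
exact: (isomorphism_of_isometry charF2 invs fks ort csA.1 uvA anisA
  invs' fks' ort' csA'.1 uvA' anisA' bijphi ffun fq).
Qed.
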